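(* Assume the information is nested: $i_0\subseteq i_1\subseteq\cdots\subseteq i_{T-1}\subseteq i_T$. Let the value function be $$V_t(i_t):=\min_{K_t,\ldots,K_{T-1}}\mathbb{E}\Big[g_T(x_T)+\sum_{j=t}^{T-1}g_j(x_j,u_j)\,\Big|\,i_t\Big].$$ Then the value function satisfies the following backwards recursion starting from $t=T$: $$V_T(i_T)=\mathbb{E}[g_T(x_T)\mid i_T],$$ $$V_t(i_t)=\min_{u}\mathbb{E}\big[g_t(x_t,u_t)+V_{t+1}(i_{t+1})\,\big|\,i_t,\,u_t=u\big]\quad\text{for } t=0,\ldots,T-1.\qquad( * )$$ Moreover, the optimal cost $J^*(i_0)=\min_K J(K,i_0)$ is achieved by the deterministic policy defined by selecting, at each $t$, $u_t=k_t(i_t)$ to be a minimizer over $u$ of the right-hand side of $( * )$.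
   Context: Consider a discrete-time stochastic control problem on a finite horizon $t=0,1,\ldots,T$ ($T<\infty$) with states $x_t\in\mathbb{R}^{n_x}$ ($t=0,\ldots,T$) and control inputs $u_t\in\mathbb{R}^{n_u}$ ($t=0,\ldots,T-1$), which are random variables. No specific model (e.g. no linearity or Markov property) relating $x_{t+1}$ to $(x_t,u_t)$ is assumed. At time $t$ the controller has access to information $i_t$ (a collection of random variables); $i_t\subseteq i_{t+1}$ means that all information available at time $t$ is also available at time $t+1$. A (possibly randomized) policy at time $t$ is a conditional probability density over actions given the available information, $K_t(u_t,i_t):=\mathrm{Prob}(u_t\mid i_t)$. Deterministic policies $u_t=k_t(i_t)$ are included as a special case. A sequence of policies is denoted $K=\{K_0,\ldots,K_{T-1}\}$. Per-step cost functions $g_0,\ldots,g_T$ are given (with $g_t$ a function of $(x_t,u_t)$ for $t<T$ and $g_T$ a function of $x_T$). No specific structure of these functions is assumed. The cost is $$J(K,i_0):=\mathbb{E}\Big[g_T(x_T)+\sum_{t=0}^{T-1}g_t(x_t,u_t)\,\Big|\,i_0\Big],$$ and the goal is to find $J^*(i_0)=\min_K J(K,i_0)$. The value function $V_t$ (optimal cost-to-go) is regarded as a function of $i_t$, and $V_0(i_0)=J^*(i_0)$. The minima written are understood to be attained. *)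

(* Defs.v *)
From HB Require Import structures.
From mathcomp Require Import all_boot all_order all_algebra.
From mathcomp Require Import all_classical all_reals all_analysis measurable_realfun.

Set Implicit Arguments.
Unset Strict Implicit.
Unset Printing Implicit Defensive.

Import Order.TTheory GRing.Theory Num.Theory.
Import numFieldNormedType.Exports.

Local Open Scope classical_set_scope.
Local Open Scope ring_scope.
Local Open Scope ereal_scope.

(* R^n with its Borel sigma-algebra (the product of the Borel sigma-algebras). *)
Notation Rvec R n := (n.-tuple (measurableTypeR R)).

Definition is_minimum (R : realType) (A : set (\bar R)) (v : \bar R) : Prop :=
  A v /\ lbound A v.

(* [is_cond_exp P f Z m]: m is a version of y |-> E_P[Z | f = y], that is,
   m \o f = E_P[Z | f] almost surely.  Values may be infinite; the notion is
   meaningful (and m unique up to a null set of the law of f) as soon as the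
   negative part of Z is integrable. *)
Definition is_cond_exp d d' (S : measurableType d) (Y : measurableType d')
    (R : realType) (P : probability S R) (f : S -> Y) (Z : S -> \bar R)
    (m : Y -> \bar R) : Prop :=
  measurable_fun setT m /\
  forall A : set Y, measurable A ->
    \int[P]_(w in f @^-1` A) m (f w) = \int[P]_(w in f @^-1` A) Z w.

(* All events decided before the action of time t is drawn: the sigma-algebra
   generated by x_0..x_t, i_0..i_t and u_0..u_(t-1). *)
Definition past_events d (dI : nat -> measure_display) (S : measurableType d)
    (R : realType) (nx nu : nat) (I : forall t, measurableType (dI t))
    (x : nat -> S -> Rvec R nx) (u : nat -> S -> Rvec R nu)
    (i : forall t, S -> I t) (t : nat) : set (set S) :=
  <<s [set A | exists s : nat,
         [\/ (s <= t)%N /\ preimage_set_system setT (x s) measurable A,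
             (s <= t)%N /\ preimage_set_system setT (i s) measurable A |
             (s < t)%N /\ preimage_set_system setT (u s) measurable A]] >>.

Definition policy (R : realType) (nu : nat) (dI : nat -> measure_display)
    (I : forall t, measurableType (dI t)) :=
  forall t : nat, R.-pker I t ~> Rvec R nu.

Definition agree_before (R : realType) (nu : nat) (dI : nat -> measure_display)
    (I : forall t, measurableType (dI t)) (t : nat) (K K' : policy R nu I) :=
  forall (s : nat) (y : I s) (B : set (Rvec R nu)),
    (s < t)%N -> K s y B = K' s y B.

(* States, inputs and information are random variables on one sample space whose
   law depends on the policy; [info_space t] is the space in which the
   information i_t, bundled into one random variable, takes its values.  Times
   are natural numbers: only x_0..x_T, i_0..i_T, u_0..u_(T-1) and the policies
   of times 0..T-1 matter, the other entries are unused. *)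
Record control_system (R : realType) (T nx nu : nat) := ControlSystem {
  sample_display : measure_display;
  sample : measurableType sample_display;
  info_display : nat -> measure_display;
  info_space : forall t : nat, measurableType (info_display t);
  state : nat -> {mfun sample >-> Rvec R nx};
  input : nat -> {mfun sample >-> Rvec R nu};
  info : forall t : nat, {mfun sample >-> info_space t};
  law : policy R nu info_space -> probability sample R;
  (* Given everything that happened before, u_t is drawn from K_t(. | i_t). *)
  law_input : forall (K : policy R nu info_space) (t : nat) (A : set sample)
                     (B : set (Rvec R nu)),
    (t < T)%N -> past_events state input info t A -> measurable B ->
    law K (A `&` input t @^-1` B) = \int[law K]_(w in A) K t (info t w) B;
  (* What happens before u_t is drawn does not depend on K_t, K_(t+1), ... *)
  law_causal : forall (K K' : policy R nu info_space) (t : nat) (A : set sample),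
    (t <= T)%N -> agree_before t K K' ->
    past_events state input info t A -> law K A = law K' A
}.

Arguments sample {R T nx nu} c.
Arguments info_space {R T nx nu} c t.
Arguments state {R T nx nu} c t.
Arguments input {R T nx nu} c t.
Arguments info {R T nx nu} c t.
Arguments law {R T nx nu} c K.

Section control.
Variables (R : realType) (T nx nu : nat) (S : control_system R T nx nu).

Local Notation policy := (policy R nu (info_space S)).

Definition det_policy (k : forall t, {mfun info_space S t >-> Rvec R nu}) :
    policy :=
  fun t => kdirac (@measurable_funPT _ _ _ _ (k t)).

Definition nested_information : Prop :=
  forall t : nat, (t < T)%N ->
    preimage_set_system setT (info S t) measurable `<=`
    preimage_set_system setT (info S t.+1) measurable.

Variables (g : nat -> {mfun (Rvec R nx * Rvec R nu)%type >-> measurableTypeR R})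
          (gT : {mfun Rvec R nx >-> measurableTypeR R}).

Definition step_cost (t : nat) (w : sample S) : R :=
  g t (state S t w, input S t w).

Definition final_cost (w : sample S) : R := gT (state S T w).

Definition cost_to_go (t : nat) (w : sample S) : \bar R :=
  (final_cost w + \sum_(t <= j < T) step_cost j w)%:E.

(* Under every policy the negative parts of the costs are integrable, so that
   all (conditional) expectations are well defined, with values in ]-oo, +oo]. *)
Definition well_posed : Prop :=
  forall K : policy,
    \int[law S K]_w ((EFin \o final_cost)^\- w) < +oo /\
    forall t, (t < T)%N -> \int[law S K]_w ((EFin \o step_cost t)^\- w) < +oo.

(* v(i_t) = min over K_t, ..., K_(T-1) of E[cost_to_go t | i_t], whatever the
   policies K0_0, ..., K0_(t-1) used before t.  The minimum is that of a family
   of random variables: almost surely a lower bound, and a member. *)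
Definition is_value_function (t : nat) (v : info_space S t -> \bar R) : Prop :=
  forall K0 : policy,
    (exists2 K, agree_before t K0 K &
       is_cond_exp (law S K) (info S t) (cost_to_go t) v) /\
    (forall K, agree_before t K0 K -> forall m,
       is_cond_exp (law S K) (info S t) (cost_to_go t) m ->
       {ae law S K, forall w, v (info S t w) <= m (info S t w)}).

(* J is (a version of) J(K, .). *)
Definition is_cost (K : policy) (J : info_space S 0 -> \bar R) : Prop :=
  is_cond_exp (law S K) (info S 0) (cost_to_go 0) J.

Definition is_optimal_cost (Jstar : info_space S 0 -> \bar R) : Prop :=
  (exists K, is_cost K Jstar) /\
  (forall K J, is_cost K J ->
     {ae law S K, forall w, Jstar (info S 0 w) <= J (info S 0 w)}).

(* q(y, a) = E[g_t(x_t, u_t) + V_(t+1)(i_(t+1)) | i_t = y, u_t = a], under every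
   policy.  Ranging over all policies is what gives a meaning to fixed actions
   a, which are null events under a policy with a density. *)
Definition is_action_value (V : forall t, info_space S t -> \bar R) (t : nat)
    (q : info_space S t * Rvec R nu -> \bar R) : Prop :=
  forall K : policy,
    is_cond_exp (law S K) (fun w => (info S t w, input S t w))
      (fun w => (step_cost t w)%:E + V t.+1 (info S t.+1 w)) q.

Definition selects_minimizer (t : nat)
    (q : info_space S t * Rvec R nu -> \bar R)
    (k : {mfun info_space S t >-> Rvec R nu}) : Prop :=
  forall K : policy,
    {ae law S K, forall w, forall a : Rvec R nu,
       q (info S t w, k (info S t w)) <= q (info S t w, a)}.

End control.

(* Main.v *)
(* Let k be a selection of minimizers of Q.  Both inequalities between V_t(i_t)
   and Q_t(i_t, k_t(i_t)) come from comparing integrals over events of sigma(i_t),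
   which are events of sigma(i_(t+1)) by nestedness.  For "<=", play any policy
   before t, then k_t, then a continuation attaining V_(t+1): its conditional cost
   given i_t is Q_t(i_t, k_t(i_t)), and V_t is a lower bound.  For ">=", take a
   continuation attaining V_t: its cost from t+1 on has a conditional expectation
   given i_(t+1), which is at least V_(t+1), and Q_t(i_t, u_t) is at least
   Q_t(i_t, k_t(i_t)).  Causality carries null sets of the past from one
   continuation to another.  Backward induction along k then shows that k attains
   every V_t. *)
Require Import Defs.
From HB Require Import structures.
From mathcomp Require Import all_boot all_order all_algebra.
From mathcomp Require Import all_classical all_reals all_analysis measurable_realfun.
From mathcomp Require Import lra.

Set Implicit Arguments.
Unset Strict Implicit.
Unset Printing Implicit Defensive.

Import Order.TTheory GRing.Theory Num.Theory.

Local Open Scope classical_set_scope.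
Local Open Scope ring_scope.
Local Open Scope ereal_scope.

(** * Positive and negative parts on the extended reals *)

(** Relating the parts of [x - y] through sums of nonnegative terms lets the relation be integrated
    term by term. It survives [x = y = +oo], where [x - y] is [-oo]. *)
Lemma maxe_sub_cross (R : realType) (x y : \bar R) : 0 <= x -> 0 <= y ->
  maxe (x - y) 0 + y = maxe (- (x - y)) 0 + x.
Proof.
case: x => [a| |]; case: y => [b| |] //=; rewrite ?lee_fin => a0 b0.
- rewrite -!EFin_max /= -!EFinD; congr (_%:E).
  by rewrite /Num.max; case: ltP => ?; case: ltP => ?; lra.
all: by rewrite /maxe /= ?ltNyr ?ltry.
Qed.

Lemma maxe_opp_sub_le (R : realType) (x y : \bar R) : 0 <= x -> 0 <= y ->
  maxe (- (x - y)) 0 <= y.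
Proof.
case: x => [a| |]; case: y => [b| |] //=; rewrite ?lee_fin => a0 b0.
- rewrite -!EFin_max /= lee_fin.
  by rewrite /Num.max; case: ltP => ?; lra.
all: by rewrite /maxe /= ?ltNyr ?ltry //= ?leey.
Qed.

(** As [r] is finite, at most one of the four parts is infinite, so the difference is never
    [+oo - +oo]. *)
Lemma adde_pos_neg_parts (R : realType) (r : R) (y : \bar R) :
  r%:E + y = maxe r%:E 0 + maxe y 0 - (maxe (- r%:E) 0 + maxe (- y) 0).
Proof.
case: y => [a| |] /=.
- rewrite -!EFin_max /= -!EFinD; congr (_%:E).
  by rewrite /Num.max; case: ltP => ?; case: ltP => ?; case: ltP => ?;
    case: ltP => ?; lra.
- by rewrite /maxe /= ?ltNyr ?ltry /=; case: ifP; case: ifP.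
- by rewrite /maxe /= ?ltNyr ?ltry /=; case: ifP; case: ifP.
Qed.

(** * Integrals of functions with integrable negative part *)

Section quasi_integrable.
Context d (T : measurableType d) (R : realType).
Variables (mu : {measure set T -> \bar R}) (D : set T).
Hypothesis mD : measurable D.
Implicit Types f g : T -> \bar R.

(** Passing from [f] to [g] raises the positive part and lowers the negative one, and extended
    subtraction stays monotone even through [+oo - +oo = -oo]. *)
Lemma ae_le_integral f g : measurable_fun D f -> measurable_fun D g ->
  {ae mu, forall x, f x <= g x} ->
  \int[mu]_(x in D) f x <= \int[mu]_(x in D) g x.
Proof.
move=> mf mg fg; rewrite integralE [leRHS]integralE leeB//.
- apply: ae_ge0_le_integral => //; try exact: measurable_funepos.
  apply: filterS fg => x fg _; rewrite !funeposE.
  by rewrite ge_max !le_max fg lexx orbT.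
- apply: ae_ge0_le_integral => //; try exact: measurable_funeneg.
  apply: filterS fg => x fg _; rewrite !funenegE.
  by rewrite ge_max !le_max leeN2 fg lexx orbT.
Qed.

Lemma le_integral_on f g : measurable_fun D f -> measurable_fun D g ->
  (forall x, D x -> f x <= g x) ->
  \int[mu]_(x in D) f x <= \int[mu]_(x in D) g x.
Proof.
move=> mf mg fg; rewrite integralE [leRHS]integralE leeB//.
- apply: ge0_le_integral => //; try exact: measurable_funepos.
  by move=> x Dx; apply: (funepos_le (D:=D)); rewrite ?inE// => z;
    rewrite inE; exact: fg.
- apply: ge0_le_integral => //; try exact: measurable_funeneg.
  by move=> x Dx; apply: (funeneg_le (D:=D)); rewrite ?inE// => z;
    rewrite inE; exact: fg.
Qed.

(* Also true where f and g are both +oo (then f - g = -oo). *)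
Lemma integral_ge0B f g :
  measurable_fun D f -> measurable_fun D g ->
  (forall x, 0 <= f x) -> (forall x, 0 <= g x) ->
  \int[mu]_(x in D) g x < +oo ->
  \int[mu]_(x in D) (f x - g x) =
  \int[mu]_(x in D) f x - \int[mu]_(x in D) g x.
Proof.
move=> mf mg f0 g0 goo.
set h := fun x => f x - g x.
have mh : measurable_fun D h by exact: emeasurable_funB.
have mhp := measurable_funepos mh; have mhn := measurable_funeneg mh.
have hE x : h^\+ x + g x = h^\- x + f x.
  by rewrite funeposE funenegE maxe_sub_cross.
rewrite [LHS]integralE -/h.
have hnfin : \int[mu]_(x in D) h^\- x \is a fin_num.
  rewrite ge0_fin_numE; last by apply: integral_ge0.
  apply: le_lt_trans goo; apply: ge0_le_integral => //.
  by move=> x Dx; rewrite funenegE maxe_opp_sub_le.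
have gfin : \int[mu]_(x in D) g x \is a fin_num.
  by rewrite ge0_fin_numE//; apply: integral_ge0.
(* Integrate [hE] and move the integrals of [g] and [h^\-] across: these two are finite, the other
   two may be infinite. *)
have : \int[mu]_(x in D) (h^\+ x + g x) = \int[mu]_(x in D) (h^\- x + f x).
  by apply: eq_integral => x _; exact: hE.
rewrite !ge0_integralD// => E.
by rewrite -(addeK (\int[mu]_(x in D) h^\+ x) gfin) E addeAC
  (addeC (\int[mu]_(x in D) h^\- x)) addeK.
Qed.

(** The sum is regrouped as a difference of two nonnegative functions, the subtracted one having a
    finite integral, which reduces additivity to [integral_ge0B]. *)
Lemma integralD_quasi (f : T -> R) g :
  measurable_fun D f -> measurable_fun D g ->
  \int[mu]_(x in D) (EFin \o f)^\- x < +oo ->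
  \int[mu]_(x in D) g^\- x < +oo ->
  \int[mu]_(x in D) ((f x)%:E + g x) =
  \int[mu]_(x in D) (f x)%:E + \int[mu]_(x in D) g x.
Proof.
move=> mf mg foo goo; set F := EFin \o f.
have mF : measurable_fun D F by exact/measurable_EFinP.
have mFp := measurable_funepos mF; have mFn := measurable_funeneg mF.
have mgp := measurable_funepos mg; have mgn := measurable_funeneg mg.
transitivity (\int[mu]_(x in D) ((F^\+ x + g^\+ x) - (F^\- x + g^\- x))).
  apply: eq_integral => x _.
  by rewrite !funeposE !funenegE -adde_pos_neg_parts.
rewrite integral_ge0B; [|exact: emeasurable_funD|exact: emeasurable_funD
  |by move=> x; exact: adde_ge0|by move=> x; exact: adde_ge0|]; last first.
  by rewrite ge0_integralD// lte_add_pinfty.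
rewrite !ge0_integralD// -[\int[mu]_(x in D) (f x)%:E]/(\int[mu]_(x in D) F x).
rewrite (integralE mu D F) (integralE mu D g) fin_num_oppeD.
  by rewrite addeACA.
by rewrite ge0_fin_numE//; apply: integral_ge0.
Qed.

Lemma integral_gtNy f : \int[mu]_(x in D) f^\- x < +oo ->
  -oo < \int[mu]_(x in D) f x.
Proof.
move=> foo; rewrite integralE ltNye adde_eq_ninfty eqe_oppLR/= negb_or.
by rewrite (lt_eqF foo) andbT -ltNye (lt_le_trans (ltNyr 0%R))// integral_ge0.
Qed.

Lemma integral_funeneg_restrict_lty f : measurable_fun setT f ->
  \int[mu]_x f^\- x < +oo -> \int[mu]_(x in D) f^\- x < +oo.
Proof.
move=> mf; apply: le_lt_trans; apply: ge0_subset_integral => //.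
exact: measurable_funeneg.
Qed.

End quasi_integrable.

(** * Almost sure comparison from comparison of integrals *)

Lemma ereal_rat_between (R : realType) (x y : \bar R) : x < y ->
  exists q : rat, x < (ratr q)%:E < y.
Proof.
have real_between (a b : R) : (a < b)%R ->
    exists q : rat, a%:E < (ratr q)%:E < b%:E.
  by move=> /rat_in_itvoo[q]; rewrite in_itv /= => ?; exists q; rewrite !lte_fin.
case: x => [a| |]; case: y => [b| |] //= xy.
- exact: real_between.
- have [|q /andP[aq _]] := real_between a (a + 1)%R; first by rewrite ltrDl.
  by exists q; rewrite aq ltry.
- have [|q /andP[_ qb]] := real_between (b - 1)%R b; first by rewrite ltrBlDr ltrDl.
  by exists q; rewrite qb ltNyr.
- by exists 0%R; rewrite ltNyr ltry.
Qed.

Section conditional_comparison.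
Context d d' (S : measurableType d) (Y : measurableType d') (R : realType).
Variables (P : probability S R) (f : S -> Y).
Hypothesis mf : measurable_fun setT f.

Let mpre (A : set Y) : measurable A -> measurable (f @^-1` A).
Proof. by move=> mA; rewrite -[_ @^-1` _]setTI; exact: mf. Qed.

(* No integrability is needed: on {psi <= r < s <= phi}, with r and s rational,
   the two integrals are bounded by r P and s P. *)
Lemma ae_le_of_le_integral (phi psi : Y -> \bar R) :
  measurable_fun setT phi -> measurable_fun setT psi ->
  (forall A, measurable A -> \int[P]_(w in f @^-1` A) phi (f w) <=
                            \int[P]_(w in f @^-1` A) psi (f w)) ->
  {ae P, forall w, phi (f w) <= psi (f w)}.
Proof.
move=> mphi mpsi le_int.
pose A (rs : rat * rat) : set Y :=
  [set y | psi y <= (ratr rs.1)%:E] `&` [set y | (ratr rs.2)%:E <= phi y].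
have mA rs : measurable (A rs).
  apply: measurableI.
    by rewrite -[X in measurable X]setTI; apply: measurable_lee.
  by rewrite -[X in measurable X]setTI; apply: measurable_lee.
have A0 rs : (rs.1 < rs.2)%R -> P (f @^-1` A rs) = 0.
  move=> lt_rs; have mfA := mpre (mA rs).
  have mphif : measurable_fun (f @^-1` A rs) (phi \o f).
    by apply: measurable_funTS; exact: measurableT_comp.
  have mpsif : measurable_fun (f @^-1` A rs) (psi \o f).
    by apply: measurable_funTS; exact: measurableT_comp.
  have lo : (ratr rs.2)%:E * P (f @^-1` A rs) <=
      \int[P]_(w in f @^-1` A rs) phi (f w).
    rewrite -(integral_cst P)//; apply: le_integral_on => //.
    by move=> w [].
  have hi : \int[P]_(w in f @^-1` A rs) psi (f w) <=
      (ratr rs.1)%:E * P (f @^-1` A rs).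
    rewrite -(integral_cst P)//; apply: le_integral_on => //.
    by move=> w [].
  have := le_trans lo (le_trans (le_int _ (mA rs)) hi).
  have : 0 <= P (f @^-1` A rs) by exact: measure_ge0.
  have : P (f @^-1` A rs) \is a fin_num by exact: fin_num_measure.
  move=> /fineK <-; set p := fine _.
  rewrite -!EFinM !lee_fin => p0 le21.
  have : (ratr rs.1 < ratr rs.2 :> R)%R by rewrite ltr_rat.
  by move=> rs12; congr (_%:E); apply/eqP; rewrite eq_le p0 andbT;
    move: le21; rewrite -subr_le0 -mulrBl pmulr_rle0 ?subr_gt0.
(* [pickle] enumerates the pairs of rationals; codes of no pair, and pairs that are not increasing,
   give the empty set. *)
pose F n : set S := if @unpickle (rat * rat)%type n is Some rs then
  if (rs.1 < rs.2)%R then f @^-1` A rs else set0 else set0.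
apply: (@negligibleS _ _ _ P (\bigcup_n F n)).
  move=> w /= /negP; rewrite -ltNge => /ereal_rat_between[r /andP[psir rphi]].
  have [s /andP[rs sphi]] := ereal_rat_between rphi.
  exists (pickle (r, s)); first exact: I.
  rewrite /F pickleK; move: rs; rewrite lte_fin ltr_rat /= => ->.
  by split; rewrite /= ltW.
apply: negligible_bigcup => n; rewrite /F.
case: (unpickle n) => [rs|]; last exact: negligible_set0.
case: ifPn => [rs12|_]; last exact: negligible_set0.
exists (f @^-1` A rs); split => //; [exact: mpre|exact: A0].
Qed.

End conditional_comparison.

(** * Existence and integrability of conditional expectations *)

Section conditional_expectation.
Context d d' (S : measurableType d) (Y : measurableType d') (R : realType).
Variables (P : probability S R) (f : {mfun S >-> Y}).

Let mpre (A : set Y) : measurable A -> measurable (f @^-1` A).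
Proof. by move=> mA; rewrite -[_ @^-1` _]setTI; exact: measurable_funP. Qed.

(** The integral of [Z] over [E] and the preimage of [A], as a function of [A], is a measure on [Y].
    The bound [c] makes it finite and dominated by the distribution of [f]; [m] is its Radon-Nikodym
    density. *)
Lemma cond_exp_exists_bounded (Z : S -> R) (E : set S) (c : R) :
  measurable_fun setT Z -> measurable E ->
  (forall w, 0 <= Z w)%R -> (forall w, E w -> Z w <= c)%R ->
  exists m : Y -> \bar R, [/\ measurable_fun setT m, forall y, 0 <= m y &
    forall A, measurable A ->
      \int[P]_(w in f @^-1` A) m (f w) =
      \int[P]_(w in E `&` f @^-1` A) (Z w)%:E].
Proof.
move=> mZ mE Z0 Zc.
have mEZ : measurable_fun setT (EFin \o Z) by exact/measurable_EFinP.
pose nu := fun A : set Y => \int[P]_(w in E `&` f @^-1` A) (Z w)%:E.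
have nu0 : nu set0 = 0 by rewrite /nu preimage_set0 setI0 integral_set0.
have nu_ge0 A : 0 <= nu A by apply: integral_ge0 => w _; rewrite lee_fin.
have nu_sigma : semi_sigma_additive nu.
  move=> /= F mF tF mUF; rewrite /nu; apply: cvg_toP.
    apply: ereal_nondecreasing_is_cvgn => m n mn.
    apply: lee_sum_nneg_natr => // k _ _; exact: nu_ge0.
  rewrite preimage_bigcup setI_bigcupr ge0_integral_bigcup//=.
  - by move=> k; apply: measurableI => //; exact: mpre.
  - exact: measurable_funTS.
  - by move=> x _; rewrite lee_fin.
  - move=> i j _ _ [w [[_ Fiw] [_ Fjw]]].
    by apply: (tF i j) => //; exists (f w).
have mEf A : measurable A -> measurable (E `&` f @^-1` A).
  by move=> mA; apply: measurableI => //; exact: mpre.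
have nu_le A : measurable A -> nu A <= c%:E * P (E `&` f @^-1` A).
  move=> mA; have mEA := mEf _ mA.
  rewrite -(integral_cst P)//; apply: le_integral_on => //.
    exact: measurable_funTS.
  by move=> w [Ew _]; rewrite lee_fin; exact: Zc.
have nu_fin : fin_num_fun nu.
  move=> A mA; rewrite ge0_fin_numE//; apply: le_lt_trans (nu_le _ mA) _.
  have : P (E `&` f @^-1` A) \is a fin_num.
    by apply: fin_num_measure; exact: mEf.
  by move=> /fineK <-; rewrite -EFinM ltry.
pose nu_measure := isMeasure.Build _ _ _ nu nu0 nu_ge0 nu_sigma.
pose nuM : {measure set Y -> \bar R} := HB.pack nu nu_measure.
pose nuF : {finite_measure set Y -> \bar R} :=
  HB.pack nu nu_measure (Measure_isFinite.Build _ _ _ nuM nu_fin).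
pose mu : probability Y R := distribution P f.
have dom : nuF `<< mu.
  apply/null_content_dominatesP => A mA muA0.
  apply/eqP; rewrite eq_le nu_ge0 andbT.
  have PEA0 : P (E `&` f @^-1` A) = 0.
    apply: (@subset_measure0 _ _ _ P _ (f @^-1` A)) => //.
    - exact: mEf.
    - exact: mpre.
  by have := nu_le _ mA; rewrite PEA0 mule0.
have [h [h0 _ /integrableP[mh _] hE]] := radon_nikodym_sigma_finite dom.
exists h; split => // A mA.
rewrite -[RHS]/(nuF A) hE// ge0_integral_pushforward//.
exact: measurable_funTS.
Qed.

(* Radon-Nikodym needs a finite measure, and Z may fail to be integrable: sum the
   conditional expectations of the pieces of Z on {n <= Z < n + 1}. *)
Lemma cond_exp_exists_ge0 (Z : S -> R) :
  measurable_fun setT Z -> (forall w, 0 <= Z w)%R ->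
  exists m : Y -> \bar R, [/\ measurable_fun setT m, forall y, 0 <= m y &
    forall A, measurable A ->
      \int[P]_(w in f @^-1` A) m (f w) = \int[P]_(w in f @^-1` A) (Z w)%:E].
Proof.
move=> mZ Z0.
pose E n : set S := [set w | n%:R <= Z w < n.+1%:R]%R.
have mE n : measurable (E n).
  rewrite [E n](_ : _ = Z @^-1` `[n%:R, n.+1%:R[%classic).
    by rewrite -[_ @^-1` _]setTI; exact: mZ.
  by apply/seteqP; split => w /=; rewrite in_itv.
have bounded n w : E n w -> (Z w <= n.+1%:R)%R by move=> /andP[_ /ltW].
have [m mP] := choice (fun n =>
  cond_exp_exists_bounded mZ (mE n) Z0 (bounded n)).
have m0 n y : 0 <= m n y by have [_ ->] := mP n.
have mm n : measurable_fun setT (m n) by have [] := mP n.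
exists (fun y => \sum_(n <oo) m n y); split.
- apply: (@ge0_emeasurable_sum _ _ _ setT m predT) => [n y _ _|n _].
    exact: m0.
  exact: mm.
- by move=> y; apply: nneseries_ge0 => n _ _; exact: m0.
move=> A mA; have mfA := mpre mA.
rewrite integral_nneseries//; last first.
  move=> n; apply: measurable_funTS; exact: measurableT_comp.
have -> : f @^-1` A = \bigcup_n (E n `&` f @^-1` A).
  rewrite -setI_bigcupl setIidr// => w _; exists (Num.truncn (Z w)) => //.
  exact: truncn_itv.
rewrite ge0_integral_bigcup//=.
- apply: eq_eseriesr => n _.
  rewrite -setI_bigcupl setIidr; last first.
    by move=> w _; exists (Num.truncn (Z w)) => //; exact: truncn_itv.
  by have [_ _ ->] := mP n.
- by move=> n; exact: measurableI.
- by apply: measurable_funTS; exact/measurable_EFinP.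
- by move=> w _; rewrite lee_fin.
- move=> i j _ _ [w [[/andP[iZ Zi] _] [/andP[jZ Zj] _]]].
  have := le_lt_trans iZ Zj; have := le_lt_trans jZ Zi.
  by rewrite !ltr_nat !ltnS => ji ij; apply/eqP; rewrite eqn_leq ij.
Qed.

(** Subtract the conditional expectations of the two parts of [Z]. The subtracted one has a finite
    integral, so [integral_ge0B] applies. *)
Lemma cond_exp_exists (Z : S -> R) :
  measurable_fun setT Z -> \int[P]_w (EFin \o Z)^\- w < +oo ->
  exists m, is_cond_exp P f (EFin \o Z) m.
Proof.
move=> mZ Zoo.
have mZp : measurable_fun setT (Z ^\+)%R by exact: measurable_funrpos.
have mZn : measurable_fun setT (Z ^\-)%R by exact: measurable_funrneg.
have [p [mp p0 pE]] := cond_exp_exists_ge0 mZp (funrpos_ge0 Z).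
have [n [mn n0 nE]] := cond_exp_exists_ge0 mZn (funrneg_ge0 Z).
have Zneg : EFin \o (Z ^\-)%R = (EFin \o Z)^\-.
  by apply/funext => w; rewrite funenegE /= /funrneg EFin_max.
have Zpos : EFin \o (Z ^\+)%R = (EFin \o Z)^\+.
  by apply/funext => w; rewrite funeposE /= /funrpos EFin_max.
exists (fun y => p y - n y); split; first exact: emeasurable_funB.
move=> A mA; have mfA := mpre mA.
have mpf : measurable_fun (f @^-1` A) (p \o f).
  by apply: measurable_funTS; exact: measurableT_comp.
have mnf : measurable_fun (f @^-1` A) (n \o f).
  by apply: measurable_funTS; exact: measurableT_comp.
rewrite integral_ge0B//; last first.
  rewrite nE//; apply: le_lt_trans Zoo; rewrite -Zneg.
  apply: ge0_subset_integral => //; last by move=> w _; rewrite lee_fin funrneg_ge0.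
  exact/measurable_EFinP.
rewrite [RHS]integralE pE// nE//; congr (_ - _).
- by rewrite -Zpos.
- by rewrite -Zneg.
Qed.

(** Test against the event where [m] is negative: there the integral of [m \o f] is minus that of
    its negative part, and it equals an integral of [Z], which is above [-oo]. *)
Lemma cond_exp_neg_integrable (Z : S -> \bar R) (m : Y -> \bar R) :
  measurable_fun setT Z ->
  \int[P]_w Z^\- w < +oo -> is_cond_exp P f Z m ->
  \int[P]_w (m \o f)^\- w < +oo.
Proof.
move=> mZ Zoo [mm mE].
pose A := [set y | m y < 0].
have mA : measurable A.
  by rewrite -[A]setTI; apply: measurable_lte.
have mfA := mpre mA.
have mmf : measurable_fun setT (m \o f) by exact: measurableT_comp.
have mmn : measurable_fun setT (m \o f)^\- by exact: measurable_funeneg.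
have lt : -oo < \int[P]_(w in f @^-1` A) m (f w).
  rewrite mE//; apply: integral_gtNy; apply: le_lt_trans Zoo.
  by apply: ge0_subset_integral => //; exact: measurable_funeneg.
have eqA : \int[P]_(w in f @^-1` A) m (f w) = - \int[P]_w (m \o f)^\- w.
  rewrite integralE [X in X - _]integral0_eq ?sub0e.
    congr (- _); rewrite [LHS]integral_mkcond.
    apply: eq_integral => w _; rewrite patchE; case: ifPn => //.
    rewrite notin_setE /A /= => /negP; rewrite -leNgt => m0.
    by rewrite funenegE /=; apply/esym/max_idPr; rewrite leeNl oppe0.
  move=> w /= /ltW m0; rewrite funeposE; exact/max_idPr.
by move: lt; rewrite eqA lteNr /=.
Qed.

End conditional_expectation.

(* Both sides are integrals against one measure, the common restriction of P and
   P' to <<s G >>, obtained as the pushforward by the identity. *)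
Lemma integral_eq_on_sigma d (T : measurableType d) (R : realType)
    (P P' : {measure set T -> \bar R}) (G : set (set T)) :
  <<s G >> `<=` measurable -> (forall A, <<s G >> A -> P A = P' A) ->
  forall (phi : T -> \bar R) (D : set T),
    measurable_fun (setT : set (g_sigma_algebraType G)) phi -> <<s G >> D ->
    \int[P]_(w in D) phi w = \int[P']_(w in D) phi w.
Proof.
move=> Gm PP' phi D mphi GD.
pose j : T -> g_sigma_algebraType G := id.
have mj : measurable_fun setT j by move=> _ A /Gm; rewrite setTI.
suff ge0_case psi : measurable_fun (setT : set (g_sigma_algebraType G)) psi ->
    (forall w, 0 <= psi w) ->
    \int[P]_(w in D) psi w = \int[P']_(w in D) psi w.
  rewrite integralE [RHS]integralE; congr (_ - _); apply: ge0_case => //.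
  - exact: (@measurable_funepos _ (g_sigma_algebraType G)).
  - exact: (@measurable_funeneg _ (g_sigma_algebraType G)).
move=> mpsi psi0.
have mpsiD : measurable_fun (D : set (g_sigma_algebraType G)) psi.
  apply: (@measurable_funS _ _ (g_sigma_algebraType G) _ setT) => //.
have change_var Q := @ge0_integral_pushforward _ _ T (g_sigma_algebraType G) R
  j mj Q D psi GD mpsiD (fun y _ => psi0 y).
rewrite -[LHS](change_var P) -[RHS](change_var P').
by apply: eq_measure_integral => A mA _; exact: PP'.
Qed.

(** The negative part of a sum is at most the sum of the negative parts. *)
Lemma neg_integrableD d (T : measurableType d) (R : realType)
    (mu : {measure set T -> \bar R}) (f : T -> R) (g : T -> \bar R) :
  measurable_fun setT f -> measurable_fun setT g ->
  \int[mu]_w (EFin \o f)^\- w < +oo -> \int[mu]_w g^\- w < +oo ->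
  \int[mu]_w (fun x => (f x)%:E + g x)^\- w < +oo.
Proof.
move=> /measurable_EFinP mf mg foo goo.
have mfn := measurable_funeneg mf; have mgn := measurable_funeneg mg.
apply: (@le_lt_trans _ _ (\int[mu]_w ((EFin \o f)^\- w + g^\- w))).
  apply: ge0_le_integral => //.
  - by apply: measurable_funeneg; exact: emeasurable_funD.
  - exact: emeasurable_funD.
  move=> w _; rewrite !funenegE adde_pos_neg_parts maxe_opp_sub_le//.
    by rewrite adde_ge0// le_max lexx orbT.
  by rewrite adde_ge0// le_max lexx orbT.
by rewrite ge0_integralD// lte_add_pinfty.
Qed.

(** * Causality: what the laws of two policies share *)

Section control.
Variables (R : realType) (T nx nu : nat) (S : control_system R T nx nu).
Variables (g : nat -> {mfun (Rvec R nx * Rvec R nu)%type >-> measurableTypeR R})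
          (gT : {mfun Rvec R nx >-> measurableTypeR R}).

Local Notation policy := (policy R nu (info_space S)).
Local Notation past := (past_events (state S) (input S) (info S)).

(* The family generating [past t], named so that [past t] is the sigma-algebra of
   [g_sigma_algebraType (past_generators t)]. *)
Definition past_generators (t : nat) : set (set (sample S)) :=
  [set A | exists s : nat,
    [\/ (s <= t)%N /\ preimage_set_system setT (state S s) measurable A,
        (s <= t)%N /\ preimage_set_system setT (info S s) measurable A |
        (s < t)%N /\ preimage_set_system setT (input S s) measurable A]].

Lemma past_measurable t : past t `<=` measurable.
Proof.
apply: smallest_sub; first exact: sigma_algebra_measurable.
by move=> _ [s [[_ [B mB <-]]|[_ [B mB <-]]|[_ [B mB <-]]]];
  exact: measurable_funP.
Qed.

Lemma measurable_past_info t :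
  measurable_fun (setT : set (g_sigma_algebraType (past_generators t)))
    (info S t).
Proof.
move=> _ A mA; rewrite setTI; apply: sub_sigma_algebra; exists t.
by apply: Or32; split => //; exists A => //; rewrite setTI.
Qed.

Lemma measurable_past_state t :
  measurable_fun (setT : set (g_sigma_algebraType (past_generators t)))
    (state S t).
Proof.
move=> _ A mA; rewrite setTI; apply: sub_sigma_algebra; exists t.
by apply: Or31; split => //; exists A => //; rewrite setTI.
Qed.

Lemma past_info_preimage t (A : set (info_space S t)) :
  measurable A -> past t (info S t @^-1` A).
Proof. by move=> mA; rewrite -[_ @^-1` _]setTI; exact: measurable_past_info. Qed.

Lemma integral_causal (K K' : policy) t (phi : sample S -> \bar R) D :
  (t <= T)%N -> agree_before t K K' ->
  measurable_fun (setT : set (g_sigma_algebraType (past_generators t))) phi ->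
  past t D ->
  \int[law S K]_(w in D) phi w = \int[law S K']_(w in D) phi w.
Proof.
move=> tT KK' mphi pD.
apply: (@integral_eq_on_sigma _ _ _ _ _ (past_generators t)) => //.
  exact: past_measurable.
by move=> A pA; exact: (law_causal tT KK').
Qed.

(** The exceptional event is decided by i_t, hence lies in the past of [t], where the two laws
    agree. *)
Lemma ae_le_causal (K K' : policy) t (phi psi : info_space S t -> \bar R) :
  (t <= T)%N -> agree_before t K K' ->
  measurable_fun setT phi -> measurable_fun setT psi ->
  {ae law S K', forall w, phi (info S t w) <= psi (info S t w)} ->
  {ae law S K, forall w, phi (info S t w) <= psi (info S t w)}.
Proof.
move=> tT KK' mphi mpsi.
pose A := [set y | psi y < phi y].
have mA : measurable A by rewrite -[A]setTI; exact: measurable_lte.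
have AE : info S t @^-1` A =
    ~` [set w | phi (info S t w) <= psi (info S t w)].
  by apply/seteqP; split => w; rewrite /A /= ltNge => /negP.
have mB : measurable (info S t @^-1` A).
  by apply: (@past_measurable t); exact: past_info_preimage.
move=> ae'; suff : (law S K).-negligible (info S t @^-1` A) by rewrite AE.
have A0 : law S K' (info S t @^-1` A) = 0.
  by apply/negligibleP => //; rewrite AE.
apply/negligibleP => //.
exact: etrans (law_causal tT KK' (past_info_preimage mA)) A0.
Qed.

(** * Measurability and integrability of the costs *)

Lemma measurable_step_cost t : measurable_fun setT (step_cost (S:=S) g t).
Proof.
apply: (measurableT_comp (measurable_funPT (g t))).
by apply: measurable_fun_pair; exact: measurable_funPT.
Qed.

Lemma measurable_final_cost : measurable_fun setT (final_cost (S:=S) gT).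
Proof.
by apply: (measurableT_comp (measurable_funPT gT)); exact: measurable_funPT.
Qed.

Lemma measurable_total_cost t :
  measurable_fun setT
    (fun w : sample S => (final_cost gT w + \sum_(t <= j < T) step_cost g j w)%R).
Proof.
apply: measurable_funD; first exact: measurable_final_cost.
by apply: measurable_sum => j; exact: measurable_step_cost.
Qed.

Lemma cost_to_go_measurable t : measurable_fun setT (cost_to_go (S:=S) g gT t).
Proof. by apply/measurable_EFinP; exact: measurable_total_cost. Qed.

Lemma cost_to_go_last : cost_to_go (S:=S) g gT T = EFin \o final_cost gT.
Proof. by apply/funext => w; rewrite /cost_to_go big_geq// addr0. Qed.

Lemma cost_to_go_step t w : (t < T)%N ->
  cost_to_go (S:=S) g gT t w = (step_cost g t w)%:E + cost_to_go g gT t.+1 w.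
Proof. by move=> tT; rewrite /cost_to_go big_ltn// -EFinD addrCA. Qed.

Hypothesis wp : well_posed S g gT.

Lemma cost_to_go_neg_integrable (K : policy) t : (t <= T)%N ->
  \int[law S K]_w (cost_to_go g gT t)^\- w < +oo.
Proof.
(* Backward induction on [t], run as induction on the remaining time [T - t]. *)
move=> tT; rewrite -(subKn tT); elim: (T - t)%N (leq_subr t T) => [|n IH] nT.
  by rewrite subn0 cost_to_go_last; exact: (wp K).1.
have lt : (T - n.+1 < T)%N by rewrite ltn_subrL/= (leq_trans _ nT).
rewrite (_ : cost_to_go _ _ _ = fun w => (step_cost g (T - n.+1) w)%:E +
    cost_to_go g gT (T - n) w); last first.
  by apply/funext => w; rewrite cost_to_go_step// subnSK.
apply: neg_integrableD.
- exact: measurable_step_cost.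
- exact: cost_to_go_measurable.
- exact: (wp K).2.
- exact/IH/ltnW.
Qed.

(* [input t] and [k (info t)] are a.s. on the same side of every rational bound,
   in each coordinate: take B a half-space and A the event [k (info t) \notin B]
   in [law_input]. *)
Lemma ae_input_deterministic (K : policy) t
    (k : {mfun info_space S t >-> Rvec R nu}) :
  (t < T)%N -> (forall y B, K t y B = \d_(k y) B) ->
  {ae law S K, forall w, input S t w = k (info S t w)}.
Proof.
move=> tT Kk.
have mk (B : set (Rvec R nu)) : measurable B -> measurable (k @^-1` B).
  by move=> mB; rewrite -[_ @^-1` _]setTI; exact: measurable_funP.
have null (B : set (Rvec R nu)) : measurable B ->
    (law S K).-negligible
      ((info S t @^-1` (k @^-1` ~` B)) `&` input S t @^-1` B).
  move=> mB.
  have pA : past t (info S t @^-1` (k @^-1` ~` B)).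
    by apply: past_info_preimage; apply: mk; exact: measurableC.
  apply/negligibleP.
    apply: measurableI; first exact: past_measurable pA.
    by rewrite -[_ @^-1` _]setTI; exact: measurable_funP.
  apply: (etrans (@law_input _ _ _ _ S K t _ _ tT pA mB)).
  apply: integral0_eq => w nB.
  by rewrite Kk diracE memNset.
pose B (jqb : 'I_nu * rat * bool) : set (Rvec R nu) :=
  if jqb.2 then [set v | tnth v jqb.1.1 < ratr jqb.1.2]%R
  else [set v | ratr jqb.1.2 < tnth v jqb.1.1]%R.
have mB jqb : measurable (B jqb).
  case: jqb => [[j q] []]; rewrite /B /=.
    rewrite (_ : mkset _ = (@tnth _ _ ^~ j) @^-1` `]-oo, ratr q[%classic).
      by rewrite -[_ @^-1` _]setTI; exact: measurable_tnth.
    by apply/seteqP; split => v /=; rewrite in_itv.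
  rewrite (_ : mkset _ = (@tnth _ _ ^~ j) @^-1` `]ratr q, +oo[%classic).
    by rewrite -[_ @^-1` _]setTI; exact: measurable_tnth.
  by apply/seteqP; split => v /=; rewrite in_itv/= andbT.
pose F n : set (sample S) :=
  if @unpickle ('I_nu * rat * bool)%type n is Some jqb then
    (info S t @^-1` (k @^-1` ~` B jqb)) `&` input S t @^-1` B jqb else set0.
apply: (@negligibleS _ _ _ (law S K) (\bigcup_n F n)); last first.
  apply: negligible_bigcup => n; rewrite /F.
  by case: (unpickle n) => [jqb|]; [exact: null|exact: negligible_set0].
move=> w /= neq.
have [j] : exists j, tnth (input S t w) j != tnth (k (info S t w)) j.
  apply: contrapT => /forallNP all_eq; apply: neq; apply: eq_from_tnth => j.
  by apply/eqP; move: (all_eq j) => /negP; rewrite negbK.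
(* A rational strictly between the two coordinates gives a half-space containing u_t but not k(i_t);
   the Boolean records its side. *)
rewrite neq_lt => /orP[] /rat_in_itvoo[q]; rewrite in_itv/= => /andP[lt1 lt2].
- exists (pickle (j, q, true)); first exact: I.
  rewrite /F pickleK /B; split => //=.
  by apply/negP; rewrite -leNgt ltW.
- exists (pickle (j, q, false)); first exact: I.
  rewrite /F pickleK /B; split => //=.
  by apply/negP; rewrite -leNgt ltW.
Qed.

(** * One step of the recursion *)

Variables (V : forall t : nat, info_space S t -> \bar R)
          (Q : forall t : nat, info_space S t * Rvec R nu -> \bar R).
Arguments V : clear implicits.
Arguments Q : clear implicits.
Hypothesis nested : nested_information S.
Hypothesis valueP : forall t : nat, (t <= T)%N -> is_value_function g gT (V t).
Hypothesis actionP : forall t : nat, (t < T)%N -> is_action_value g V (Q t).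

(** Measurability comes with being a conditional expectation, and [valueP] produces one only from a
    given policy. *)
Lemma value_measurable (K : policy) t : (t <= T)%N ->
  measurable_fun setT (V t).
Proof. by move=> tT; have [[K' _ []]] := valueP tT K. Qed.

(** Under a continuation attaining V_t the claim is [cond_exp_neg_integrable]; it concerns i_t only,
    so causality carries it back to [K]. *)
Lemma value_neg_integrable (K : policy) t : (t <= T)%N ->
  \int[law S K]_w (V t \o info S t)^\- w < +oo.
Proof.
move=> tT; have [[K' KK' VK'] _] := valueP tT K.
have mV : measurable_fun setT (V t) by have [] := VK'.
rewrite (integral_causal tT KK').
- apply: cond_exp_neg_integrable VK'; first exact: cost_to_go_measurable.
  exact: cost_to_go_neg_integrable.
- apply: (@measurable_funeneg _ (g_sigma_algebraType (past_generators t))).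
  apply: (measurableT_comp mV); exact: measurable_past_info.
- by rewrite -(preimage_setT (info S t)); exact: past_info_preimage.
Qed.

Lemma measurable_info_preimage t (A : set (info_space S t)) :
  measurable A -> measurable (info S t @^-1` A).
Proof. by move=> mA; apply: (@past_measurable t); exact: past_info_preimage. Qed.

(** Turns events of sigma(i_t) into test events for conditioning on i_(t+1); this is where [nested]
    enters. *)
Lemma nested_preimage t (A : set (info_space S t)) : (t < T)%N -> measurable A ->
  exists2 A' : set (info_space S t.+1), measurable A' &
    info S t @^-1` A = info S t.+1 @^-1` A'.
Proof.
move=> tT mA; have [|A' mA'] := @nested t tT (info S t @^-1` A).
  by exists A => //; rewrite setTI.
by rewrite setTI => <-; exists A'.
Qed.

Lemma integral_cost_to_go_step (K : policy) t D : (t < T)%N -> measurable D ->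
  \int[law S K]_(w in D) cost_to_go g gT t w =
  \int[law S K]_(w in D) (step_cost g t w)%:E +
  \int[law S K]_(w in D) cost_to_go g gT t.+1 w.
Proof.
move=> tT mD; under eq_integral do rewrite cost_to_go_step//.
have mc := cost_to_go_measurable t.+1.
have ms := measurable_step_cost t.
rewrite integralD_quasi//.
- exact: measurable_funTS.
- exact: measurable_funTS.
- apply: integral_funeneg_restrict_lty => //; first exact/measurable_EFinP.
  exact: (wp K).2.
- apply: integral_funeneg_restrict_lty => //.
  exact: cost_to_go_neg_integrable.
Qed.

(** The cylinder [A]*[setT] is a test event for the pair (i_t, u_t), which leaves an event of
    sigma(i_t) alone. *)
Lemma integral_action_value (K : policy) t (A : set (info_space S t)) :
  (t < T)%N -> measurable A ->
  \int[law S K]_(w in info S t @^-1` A) Q t (info S t w, input S t w) =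
  \int[law S K]_(w in info S t @^-1` A) (step_cost g t w)%:E +
  \int[law S K]_(w in info S t @^-1` A) V t.+1 (info S t.+1 w).
Proof.
move=> tT mA; have [mQ QE] := actionP tT K.
have mfA := measurable_info_preimage mA.
have AE : info S t @^-1` A =
    (fun w => (info S t w, input S t w)) @^-1` (A `*` setT).
  by apply/seteqP; split => w //= -[].
rewrite {1}AE QE -?AE; last exact: measurableX.
have mV : measurable_fun setT (V t.+1 \o info S t.+1).
  apply: (measurableT_comp (value_measurable K tT)); exact: measurable_funPT.
have ms := measurable_step_cost t.
apply: (integralD_quasi (g := V t.+1 \o info S t.+1) mfA).
- exact: measurable_funTS.
- exact: measurable_funTS.
- apply: integral_funeneg_restrict_lty => //; first exact/measurable_EFinP.
  exact: (wp K).2.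
- apply: integral_funeneg_restrict_lty => //.
  exact: value_neg_integrable.
Qed.

Lemma measurable_action_value (K : policy) t : (t < T)%N ->
  measurable_fun setT (Q t).
Proof. by move=> tT; have [] := actionP tT K. Qed.

Lemma measurable_action_selection (K : policy) t
    (k : {mfun info_space S t >-> Rvec R nu}) : (t < T)%N ->
  measurable_fun setT (fun y => Q t (y, k y)).
Proof.
move=> tT; apply: (measurableT_comp (measurable_action_value K tT)).
by apply: measurable_fun_pair => //; exact: measurable_funPT.
Qed.

Lemma measurable_action_input (K : policy) t : (t < T)%N ->
  measurable_fun setT (fun w => Q t (info S t w, input S t w)).
Proof.
move=> tT; apply: (measurableT_comp (measurable_action_value K tT)).
by apply: measurable_fun_pair => //; exact: measurable_funPT.
Qed.

(** Since u_t = k(i_t) almost surely, [Q t (y, k y)] may be traded for the action value at the input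
    actually played. *)
Lemma selection_cond_exp (K : policy) t
    (k : {mfun info_space S t >-> Rvec R nu}) :
  (t < T)%N -> (forall y B, K t y B = \d_(k y) B) ->
  is_cond_exp (law S K) (info S t.+1) (cost_to_go g gT t.+1) (V t.+1) ->
  is_cond_exp (law S K) (info S t) (cost_to_go g gT t)
    (fun y => Q t (y, k y)).
Proof.
move=> tT Kk [_ VE]; split; first exact: (measurable_action_selection K).
move=> A mA; have mfA := measurable_info_preimage mA.
have mqk := measurable_action_selection K k tT.
have mqu := measurable_action_input K tT.
transitivity (\int[law S K]_(w in info S t @^-1` A)
    Q t (info S t w, input S t w)).
  apply: ae_eq_integral => //.
  - apply: measurable_funTS; apply: (measurableT_comp mqk).
    exact: measurable_funPT.
  - exact: measurable_funTS.
  by apply: filterS (ae_input_deterministic tT Kk) => w -> _.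
rewrite integral_action_value// integral_cost_to_go_step//; congr (_ + _).
(* Tower property: seen as an event of sigma(i_(t+1)), the test event gives V_(t+1) and the
   remaining cost equal integrals. *)
have [A' mA' ->] := nested_preimage tT mA.
exact: VE.
Qed.

(* The continuation K' attaining V t may be suboptimal from t+1 on, so its
   remaining cost is only bounded below by V t.+1, and its action only by the
   minimizer. *)
Lemma selection_le_value (K : policy) t
    (k : {mfun info_space S t >-> Rvec R nu}) :
  (t < T)%N -> selects_minimizer (Q t) k ->
  {ae law S K, forall w,
    Q t (info S t w, k (info S t w)) <= V t (info S t w)}.
Proof.
move=> tT sel; have [[K' KK' [mV VE]] _] := valueP (ltnW tT) K.
have mqk := measurable_action_selection K k tT.
have mqu := measurable_action_input K tT.
have mV1 := value_measurable K tT.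
(* Both sides depend on i_t only, so it suffices to argue under [K']. *)
apply: (ae_le_causal (ltnW tT) KK' mqk mV).
apply: (ae_le_of_le_integral (measurable_funPT (info S t)) mqk mV).
move=> A mA; have mfA := measurable_info_preimage mA.
apply: (@le_trans _ _ (\int[law S K']_(w in info S t @^-1` A)
    Q t (info S t w, input S t w))).
  apply: ae_le_integral => //.
  - apply: measurable_funTS; apply: (measurableT_comp mqk).
    exact: measurable_funPT.
  - exact: measurable_funTS.
  - by apply: filterS (sel K') => w; apply.
rewrite VE// integral_action_value// integral_cost_to_go_step// leeD2l//.
(* The lower bound in [valueP] is about versions of the conditional cost, so one is built for the
   cost from t+1 on under [K']. *)
have [m mP] := cond_exp_exists (P := law S K') (info S t.+1)
  (measurable_total_cost t.+1) (cost_to_go_neg_integrable K' tT).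
have [A' mA' ->] := nested_preimage tT mA.
have mfA' := measurable_info_preimage mA'.
have [mm mE] := mP.
rewrite -[leRHS]mE//; apply: ae_le_integral => //.
- apply: measurable_funTS; apply: (measurableT_comp mV1).
  exact: measurable_funPT.
- apply: measurable_funTS; apply: (measurableT_comp mm).
  exact: measurable_funPT.
have [_] := valueP tT K'; apply => //.
Qed.

(* The competitor K2 follows K before t, plays k at t, and then the continuation
   attaining V t.+1. *)
Lemma value_le_selection (K : policy)
    (k : forall t, {mfun info_space S t >-> Rvec R nu}) t :
  (t < T)%N ->
  {ae law S K, forall w,
    V t (info S t w) <= Q t (info S t w, k t (info S t w))}.
Proof.
move=> tT; pose K1 : policy := fun s => if (s < t)%N then K s else det_policy k s.
have [[K2 K12 VK2] _] := valueP tT K1.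
have KK2 : agree_before t K K2.
  by move=> s y B st; rewrite -K12 ?(ltn_trans st)// /K1 st.
have K2k y B : K2 t y B = \d_(k t y) B.
  by rewrite -K12// /K1 ltnn.
apply: (ae_le_causal (ltnW tT) KK2 (value_measurable K (ltnW tT))
  (measurable_action_selection K (k t) tT)).
have [_ Vmin] := valueP (ltnW tT) K.
apply: (Vmin _ KK2 (fun y => Q t (y, k t y))).
exact: selection_cond_exp.
Qed.

Lemma value_eq_selection (K : policy)
    (k : forall t, {mfun info_space S t >-> Rvec R nu}) t :
  (t < T)%N -> selects_minimizer (Q t) (k t) ->
  {ae law S K, forall w,
    V t (info S t w) = Q t (info S t w, k t (info S t w))}.
Proof.
move=> tT sel.
apply: filterS2 (value_le_selection K k tT)
  (selection_le_value K tT sel) => w Vq qV.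
by apply/eqP; rewrite eq_le Vq.
Qed.

(** * Attainment by the deterministic policy, backwards from [T] *)

(** No action remains at [T]: x_T and i_T belong to the past of [T], so the identity holding under
    the policy supplied by [valueP] passes to every [K]. *)
Lemma final_value (K : policy) :
  is_cond_exp (law S K) (info S T) (EFin \o final_cost gT) (V T).
Proof.
have [[K' KK' [mV VE]] _] := valueP (leqnn T) K.
rewrite cost_to_go_last in VE; split=> // A mA.
have pA := past_info_preimage mA.
rewrite (integral_causal (leqnn T) KK' _ pA); last first.
  by apply: (measurableT_comp mV); exact: measurable_past_info.
rewrite VE// (integral_causal (leqnn T) KK' _ pA)//.
apply/measurable_EFinP; apply: (measurableT_comp (measurable_funPT gT)).
exact: measurable_past_state.
Qed.

Lemma det_policy_value (k : forall t, {mfun info_space S t >-> Rvec R nu}) t :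
  (forall t, (t < T)%N -> selects_minimizer (Q t) (k t)) ->
  (t <= T)%N ->
  is_cond_exp (law S (det_policy k)) (info S t) (cost_to_go g gT t) (V t).
Proof.
move=> sel tT; rewrite -(subKn tT).
elim: (T - t)%N (leq_subr t T) => [|n IH] nT.
  by rewrite subn0 cost_to_go_last; exact: final_value.
have lt : (T - n.+1 < T)%N by rewrite ltn_subrL/= (leq_trans _ nT).
set s := (T - n.+1)%N.
(* By induction the rest of [k] attains the value at [s.+1], so the conditional cost at [s] is
   [Q s (y, k s y)]; it is then replaced by [V s], almost surely equal to it. *)
have [] := @selection_cond_exp (det_policy k) s (k s) lt (fun _ _ => erefl _).
  by rewrite /s subnSK//; exact/IH/ltnW.
move=> mq qE; split; first exact: (value_measurable (det_policy k) (ltnW lt)).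
move=> A mA; rewrite -qE//.
have mfA := measurable_info_preimage mA.
apply: ae_eq_integral => //.
- apply: measurable_funTS.
  apply: (measurableT_comp (value_measurable (det_policy k) (ltnW lt))).
  exact: measurable_funPT.
- by apply: measurable_funTS; apply: (measurableT_comp mq); exact: measurable_funPT.
by apply: filterS (value_eq_selection (det_policy k) lt (sel s lt)) => w ->.
Qed.

End control.

(** * The recursion and the optimal deterministic policy *)

Theorem theorem1 (R : realType) (T nx nu : nat) (S : control_system R T nx nu)
  (g : nat -> {mfun (Rvec R nx * Rvec R nu)%type >-> measurableTypeR R})
  (gT : {mfun Rvec R nx >-> measurableTypeR R})
  (V : forall t : nat, info_space S t -> \bar R)
  (Q : forall t : nat, info_space S t * Rvec R nu -> \bar R) :
  well_posed S g gT ->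
  nested_information S ->
  (forall t : nat, (t <= T)%N -> is_value_function g gT (V t)) ->
  (forall t : nat, (t < T)%N -> is_action_value g V (Q t)) ->
  (forall t : nat, (t < T)%N -> exists k, selects_minimizer (Q t) k) ->
  [/\ forall K : policy R nu (info_space S),
        is_cond_exp (law S K) (info S T) (EFin \o final_cost gT) (V T),
      forall t : nat, (t < T)%N -> forall K : policy R nu (info_space S),
        {ae law S K, forall w,
          is_minimum (range (fun a : Rvec R nu => Q t (info S t w, a)))
                     (V t (info S t w))},
      is_optimal_cost g gT (V 0%N)
    & forall k : (forall t : nat, {mfun info_space S t >-> Rvec R nu}),
        (forall t : nat, (t < T)%N -> selects_minimizer (Q t) (k t)) ->
        forall Jstar : info_space S 0 -> \bar R,
          is_optimal_cost g gT Jstar ->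
          is_cost g gT (det_policy k) Jstar].
Proof.
move=> wp nested valueP actionP selP.
(* Minimizers are given before [T] only; a constant map fills the later times so that [k] is
   total. *)
have selT t : exists k, (t < T)%N -> selects_minimizer (Q t) k.
  have [/selP[k kP]|_] := boolP (t < T)%N; first by exists k.
  by exists [the {mfun _ >-> _} of cst point].
pose k t := sval (cid (selT t)).
have kP t : (t < T)%N -> selects_minimizer (Q t) (k t) := svalP (cid (selT t)).
have cond_V0 k' k'P :=
  det_policy_value wp nested valueP actionP (k := k') k'P (leq0n T).
split.
- exact: final_value valueP.
- move=> t tT K.
  have eqV := value_eq_selection wp nested valueP actionP K tT (kP t tT).
  apply: filterS2 eqV (kP t tT K) => w Vq minq; split.
    by exists (k t (info S t w)).
  by move=> _ [a _ <-]; rewrite Vq.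
- split; first by exists (det_policy k); exact: cond_V0.
  by move=> K J JK; have [_ Vmin] := valueP 0%N (leq0n T) K; exact: (Vmin K).
move=> k' k'P Jstar [[K1 JK1] Jmin].
have [mJ _] := JK1; split => // A mA.
have [mV VE] := cond_V0 k' k'P.
rewrite -[RHS]VE//.
have mfA := measurable_info_preimage mA.
have JV := Jmin _ _ (cond_V0 k' k'P).
(* [Jstar] is attained by some [K1], perhaps unrelated to [k']. There V_0 is a lower bound, and any
   two policies agree before time 0, so the inequality passes to the law of [det_policy k']. With
   [JV] this makes [Jstar] and V_0 almost surely equal. *)
have VJ : {ae law S (det_policy k'), forall w,
    V 0%N (info S 0 w) <= Jstar (info S 0 w)}.
  apply: (ae_le_causal (K' := K1) (leq0n T) _ mV mJ) => //.
  by have [_ Vmin] := valueP 0%N (leq0n T) K1; exact: (Vmin K1).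
apply: ae_eq_integral => //.
- apply: measurable_funTS; apply: (measurableT_comp mJ).
  exact: measurable_funPT.
- apply: measurable_funTS; apply: (measurableT_comp mV).
  exact: measurable_funPT.
by apply: filterS2 JV VJ => w le1 le2 _; apply/eqP; rewrite eq_le le1.
Qed.
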